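(* Let $n\ge 0$ be an integer and let $p(x)$ be a polynomial with real coefficients, of degree at most $n$, that is nonnegative on $[-1,1]$ and satisfies $p(1)=1$. Then $$\max_{x\in[-1,1]}(1-x)\,p(x)\;\geq\;\frac{2}{(n+1)^2},$$ with equality if and only if $p(x)=g_n(x)$.
   Context: $T_m$ denotes the $m$-th Chebyshev polynomial of the first kind, the unique polynomial of degree $m$ with $T_m(\cos\xi)=\cos(m\xi)$. The polynomial $g_n$ is defined by $$g_n(x)=\frac{1}{(n+1)^2}\cdot\frac{1-T_{n+1}(x)}{1-x},$$ which is a polynomial of degree $n$ because $1-T_{n+1}(x)$ is divisible by $1-x$ (so its value at $x=1$ is understood as the value of the quotient polynomial). *)

(* Defs.v *)
From mathcomp Require Import all_boot all_order all_algebra.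
From mathcomp Require Import all_classical all_reals all_analysis.

Set Implicit Arguments.
Unset Strict Implicit.
Unset Printing Implicit Defensive.

Import Order.TTheory GRing.Theory Num.Theory.

Local Open Scope classical_set_scope.
Local Open Scope ring_scope.

Section Chebyshev.
Variable R : realType.
Implicit Types (m n : nat) (T : {poly R}) (x : R).

Definition is_chebyshev m T : Prop :=
  size T = m.+1 /\ forall xi : R, T.[cos xi] = cos (m%:R * xi).

(* The default value 0 is never used: see chebyshevP and is_chebyshev_uniq. *)
Definition chebyshev m : {poly R} := xget 0 [set T | is_chebyshev m T].

Fixpoint chebyshev_rec m : {poly R} :=
  match m with
  | 0 => 1
  | 1 => 'X
  | (m''.+1 as m').+1 => 2 *: ('X * chebyshev_rec m') - chebyshev_rec m''
  end.

Lemma chebyshev_rec_cos m xi :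
  (chebyshev_rec m).[cos xi] = cos (m%:R * xi).
Proof.
suff [] : (chebyshev_rec m).[cos xi] = cos (m%:R * xi) /\
  (chebyshev_rec m.+1).[cos xi] = cos (m.+1%:R * xi) by [].
elim: m => [|m [IH0 IH1]]; first by rewrite mul0r mul1r cos0 /= !hornerE.
split=> //; rewrite -[chebyshev_rec m.+2]/(_ - chebyshev_rec m).
rewrite hornerD hornerN hornerZ hornerM hornerX.
rewrite IH0 IH1.
set a := m.+1%:R * xi.
have -> : m.+2%:R * xi = a + xi.
  by rewrite /a -[in LHS]natr1 mulrDl mul1r.
have -> : m%:R * xi = a - xi.
  by rewrite /a -natr1 mulrDl mul1r addrK.
rewrite cosB cosD /= [cos xi * _]mulrC mulr_natl mulr2n opprD addrACA subrr.
by rewrite add0r.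
Qed.

Lemma size_chebyshev_rec m : size (chebyshev_rec m) = m.+1.
Proof.
suff [] : size (chebyshev_rec m) = m.+1 /\ size (chebyshev_rec m.+1) = m.+2
  by [].
elim: m => [|m [IH0 IH1]]; first by rewrite /= size_poly1 size_polyX.
split=> //; rewrite -[chebyshev_rec m.+2]/(_ - chebyshev_rec m).
have nz : chebyshev_rec m.+1 != 0 by rewrite -size_poly_eq0 IH1.
have s : size (2 *: ('X * chebyshev_rec m.+1)) = m.+3.
  by rewrite size_scale ?pnatr_eq0// mulrC size_mulX// IH1.
by rewrite size_polyDl s// size_polyN IH0.
Qed.

Lemma chebyshevP m : is_chebyshev m (chebyshev m).
Proof.
apply: (@xgetI _ 0 [set T | is_chebyshev m T] (chebyshev_rec m)).
by split; [exact: size_chebyshev_rec | exact: chebyshev_rec_cos].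
Qed.

Lemma is_chebyshev_uniq m T1 T2 :
  is_chebyshev m T1 -> is_chebyshev m T2 -> T1 = T2.
Proof.
move=> [_ h1] [_ h2]; apply/eqP; rewrite -subr_eq0; apply/eqP.
set q := T1 - T2.
pose rs := [seq (i.+1%:R)^-1 : R | i <- iota 0 (size q)].
apply: (@roots_geq_poly_eq0 _ q rs); last by rewrite size_map size_iota.
- apply/allP => _ /mapP[i _ ->].
  have hi : (i.+1%:R)^-1 \in `[(-1 : R), 1].
    rewrite in_itv/= invf_le1 ?ltr0n// ler1n andbT.
    by rewrite (le_trans (lerN10 _))// invr_ge0 ler0n.
  by rewrite /root -(acosK hi) !hornerE h1 h2 subrr.
- rewrite map_inj_uniq ?iota_uniq// => i j /invr_inj /eqP.
  by rewrite eqr_nat => /eqP [].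
Qed.

Definition gpoly n : {poly R} :=
  (n.+1%:R ^+ 2)^-1 *: ((1 - chebyshev n.+1) %/ (1 - 'X)).

(* The Euclidean division in gpoly is exact. *)
Lemma chebyshev_dvd m : 1 - 'X %| 1 - chebyshev m.
Proof.
rewrite -dvdpNl opprB -[X in 'X - X]polyC1 -root_factor_theorem /root.
rewrite !hornerE -[X in _.[X]]cos0.
by rewrite (proj2 (chebyshevP m)) mulr0 cos0 subrr.
Qed.

Lemma gpolyE n :
  (1 - 'X) * gpoly n = (n.+1%:R ^+ 2)^-1 *: (1 - chebyshev n.+1).
Proof. by rewrite /gpoly -scalerAr mulrC divpK ?chebyshev_dvd. Qed.

Definition is_max (A : set R) (M : R) : Prop := A M /\ ubound A M.

End Chebyshev.

(* Main.v *)
Require Import Defs.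
From mathcomp Require Import all_boot all_order all_algebra.
From mathcomp Require Import all_classical all_reals all_analysis.
From mathcomp Require Import ring.

Import Order.TTheory GRing.Theory Num.Theory.

Local Open Scope classical_set_scope.
Local Open Scope ring_scope.

(** Write N = n + 1.  At the Chebyshev nodes x_k = cos (k pi / N), 0 <= k <= N,
    the polynomial T_N takes the values (-1)^k, so (1 - x) g_n(x) equals 0 at
    the nodes of even index and its maximum 2 / N^2 at those of odd index.  If
    (1 - x) p(x) stays in [0, 2 / N^2] on [-1, 1], then p - g_n is nonnegative
    at the nodes x_k < 1 of even index and nonpositive at those of odd index.
    At x_0 = 1 it vanishes, since T_N'(1) = N^2 gives g_n(1) = 1 = p(1).  So
    p - g_n, of degree less than N, alternates weakly in sign along N + 1
    decreasing nodes.  Its divided difference of order N over these nodes is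
    zero, yet is a combination of the values whose coefficients alternate
    strictly in sign; hence all the values vanish and p = g_n
    ([alternating_poly_eq0], [gpoly_unique]).

    The maximum M of (1 - x) p(x) exists by compactness.  By the above
    M <= 2 / N^2 forces p = g_n, whose maximum is exactly 2 / N^2
    ([gpoly_le], [gpoly_attains]); this gives both the lower bound and the
    equality case. *)

(** The sum is the divided difference of [q], of order [m]: it is the
    coefficient of 'X^m in the Lagrange interpolant of [q] at the m + 1 nodes,
    and this interpolant is [q] itself. *)
Lemma sum_horner_div_nodes (K : fieldType) (m : nat) (x : 'I_m.+1 -> K)
    (q : {poly K}) :
  injective x -> (size q <= m)%N ->
  \sum_k q.[x k] / \prod_(j | j != k) (x k - x j) = 0.
Proof.
move=> x_inj sq.
pose B k := \prod_(j | j != k) ('X - (x j)%:P).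
pose c k := q.[x k] / \prod_(j | j != k) (x k - x j).
have sB k : size (B k) = m.+1.
  rewrite /B -big_filter size_prod_XsubC size_filter -sum1_count sum1_card.
  by rewrite cardC1 card_ord.
have BmE k : (B k)`_m = 1.
  have /monicP : B k \is monic by apply: monic_prod => j _; exact: monicXsubC.
  by rewrite lead_coefE sB.
have Bx k i : i != k -> (B k).[x i] = 0.
  by move=> ik; rewrite horner_prod (bigD1 i)//= hornerXsubC subrr mul0r.
have Bxx k : (B k).[x k] = \prod_(j | j != k) (x k - x j).
  by rewrite horner_prod; apply: eq_bigr => j _; rewrite hornerXsubC.
have qE : q = \sum_k c k *: B k.
  apply/eqP; rewrite -subr_eq0; apply/eqP.
  apply: (@roots_geq_poly_eq0 _ _ (codom x)).
  - apply/allP => _ /codomP[i ->]; rewrite /root !hornerE horner_sum.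
    rewrite (bigD1 i)//= big1 => [|k ki]; last first.
      by rewrite hornerZ Bx ?mulr0// eq_sym.
    rewrite hornerZ Bxx addr0 divfK ?subrr//.
    by apply/prodf_neq0 => j ji; rewrite subr_eq0 (inj_eq x_inj) eq_sym.
  - by rewrite /codom map_inj_uniq ?enum_uniq.
  - rewrite size_codom card_ord (leq_trans (size_polyD _ _))// geq_max.
    rewrite (leq_trans sq)//= size_polyN.
    apply: (leq_trans (size_sum _ _ _)); apply/bigmax_leqP => k _.
    by rewrite (leq_trans (size_scale_leq _ _))// sB.
rewrite -[RHS](nth_default 0 sq) [in RHS]qE coef_sum.
by apply: eq_bigr => k _; rewrite coefZ BmE mulr1.
Qed.

(** Exactly the [k] factors with [j < k] are negative. *)
Lemma sign_prod_nodes (R : realFieldType) (m : nat) (x : 'I_m.+1 -> R)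
    (k : 'I_m.+1) :
  {homo x : i j / (i < j)%N >-> j < i} ->
  0 < (-1) ^+ k * \prod_(j | j != k) (x k - x j).
Proof.
move=> x_dec.
(* Spreads the sign over the factors, one -1 for each negative one. *)
have kE : (k = \sum_(j < m.+1 | j != k) (j < k) :> nat)%N.
  rewrite big_mkcond /= -[LHS]subn0 -[LHS]muln1 -sum_nat_const_nat.
  rewrite big_nat (big_nat_widen _ _ m.+1) ?(ltnW (ltn_ord k))//.
  rewrite big_mkord big_mkcond /=; apply: eq_bigr => j _.
  by rewrite -val_eqE /=; case: ltngtP.
rewrite {1}kE -prodrXr -big_split /=.
apply: prodr_gt0 => j; rewrite -val_eqE neq_ltn => /orP[] jk.
  by rewrite jk expr1 mulN1r opprB subr_gt0 x_dec.
by rewrite ltnNge (ltnW jk) expr0 mul1r subr_gt0 x_dec.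
Qed.

(** The alternation of [q] matches that of the weights of the divided
    difference, which is therefore a zero sum of nonnegative terms. *)
Lemma alternating_poly_eq0 (R : realFieldType) (m : nat) (x : 'I_m.+1 -> R)
    (q : {poly R}) :
  {homo x : i j / (i < j)%N >-> j < i} -> (size q <= m)%N ->
  (forall k : 'I_m.+1, 0 <= (-1) ^+ k * q.[x k]) -> q = 0.
Proof.
move=> x_dec sq q_alt.
have x_inj : injective x.
  move=> i j xij; case: (ltngtP i j) => [ij|ji|/val_inj//].
    by have := x_dec _ _ ij; rewrite xij ltxx.
  by have := x_dec _ _ ji; rewrite xij ltxx.
have W (k : 'I_m.+1) : 0 < (-1) ^+ k * \prod_(j | j != k) (x k - x j).
  exact: sign_prod_nodes.
have := sum_horner_div_nodes _ _ _ _ x_inj sq.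
rewrite (eq_bigr (fun k : 'I_m.+1 => ((-1) ^+ k * q.[x k]) /
    ((-1) ^+ k * \prod_(j | j != k) (x k - x j)))) => [|k _]; last first.
  by rewrite -mulf_div divff ?mul1r// signr_eq0.
move=> /psumr_eq0P sum0.
have qx (k : 'I_m.+1) : q.[x k] = 0.
  have /eqP : (-1) ^+ k * q.[x k] /
      ((-1) ^+ k * \prod_(j | j != k) (x k - x j)) = 0.
    by apply: sum0 => // i _; rewrite divr_ge0// ltW.
  by rewrite mulf_eq0 invr_eq0 (gt_eqF (W k)) orbF mulf_eq0 signr_eq0 => /eqP.
apply: (@roots_geq_poly_eq0 _ _ (codom x)).
- by apply/allP => _ /codomP[i ->]; rewrite /root qx.
- by rewrite /codom map_inj_uniq ?enum_uniq.
- by rewrite size_codom card_ord (leq_trans sq).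
Qed.

Section ChebyshevFacts.
Context {R : realType}.

(* The polynomial, as opposed to the inequality of the same name on random
   variables. *)
Local Notation chebyshev := Defs.chebyshev.

Lemma chebyshevE m : chebyshev R m = chebyshev_rec R m.
Proof.
apply: is_chebyshev_uniq (chebyshevP R m) _.
by split; [exact: size_chebyshev_rec | exact: chebyshev_rec_cos].
Qed.

Lemma horner1_chebyshev m : (chebyshev R m).[1] = 1.
Proof. by rewrite -[X in _.[X]]cos0 (proj2 (chebyshevP R m)) mulr0 cos0. Qed.

(** By the three-term recurrence, as
    2 (1 + (m + 1)^2) - m^2 = (m + 2)^2. *)
Lemma deriv_chebyshev_horner1 m : (chebyshev R m)^`().[1] = m%:R ^+ 2.
Proof.
suff [] : (chebyshev R m)^`().[1] = m%:R ^+ 2 /\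
  (chebyshev R m.+1)^`().[1] = m.+1%:R ^+ 2 by [].
elim: m => [|m [IH0 IH1]].
  by rewrite !chebyshevE /= derivC derivX !hornerE expr0n expr1n.
split=> //.
have -> : chebyshev R m.+2 = 2 *: ('X * chebyshev R m.+1) - chebyshev R m.
  by rewrite !chebyshevE.
rewrite derivB derivZ derivM derivX !hornerE IH0 IH1 horner1_chebyshev.
by rewrite -(natr1 m.+1) -(natr1 m); ring.
Qed.

Lemma horner_gpoly n x :
  (1 - x) * (gpoly R n).[x] = (1 - (chebyshev R n.+1).[x]) / n.+1%:R ^+ 2.
Proof.
have := gpolyE R n; move: (gpoly R n) => g /(congr1 (fun q => q.[x])).
by rewrite !hornerE => ->; rewrite mulrC.
Qed.

(** The product rule at 1 applied to (1 - x) g_n(x) leaves only - g_n(1) on one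
    side, and - T_N'(1) / N^2 = -1 on the other. *)
Lemma gpoly1 n : (gpoly R n).[1] = 1.
Proof.
have := gpolyE R n; move: (gpoly R n) => g /(congr1 (fun q => q^`().[1])).
rewrite derivM derivZ !derivB derivX derivC !hornerE deriv_chebyshev_horner1.
rewrite subrr mul0r addr0 mulN1r mulrN mulVf ?expf_neq0//.
by move=> /oppr_inj.
Qed.

Lemma size_gpoly n : (size (gpoly R n) <= n.+1)%N.
Proof.
have g0 : gpoly R n != 0.
  by apply/eqP => g0; have /eqP := gpoly1 n; rewrite g0 horner0 eq_sym oner_eq0.
have s1X : size (1 - 'X : {poly R}) = 2%N by rewrite -opprB size_polyN size_XsubC.
have := gpolyE R n; move: (gpoly R n) g0 => g g0.
move/(congr1 (fun q : {poly R} => size q)).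
rewrite size_mul// -?size_poly_eq0 s1X//= add1n -[(size g <= _)%N]ltnS => ->.
rewrite (leq_trans (size_scale_leq _ _))// (leq_trans (size_polyD _ _))//.
by rewrite size_polyN (proj1 (chebyshevP R n.+1)) size_poly1 geq_max leqnn.
Qed.

Definition chebyshev_node m k : R := cos (k%:R * pi / m%:R).

Lemma chebyshev_node_itv m k : chebyshev_node m k \in `[-1, 1].
Proof. by rewrite in_itv/= cos_geN1 cos_le1. Qed.

Lemma chebyshev_node_lt m k l :
  (k < l <= m)%N -> chebyshev_node m l < chebyshev_node m k.
Proof.
case/andP=> kl lm.
have m0 : 0 < m%:R :> R by rewrite ltr0n; case: m lm kl; case: l.
have in0pi i : (i <= m)%N -> i%:R * pi / m%:R \in `[0, pi : R].
  move=> im; rewrite in_itv/= divr_ge0 ?mulr_ge0 ?pi_ge0//=.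
  by rewrite ler_pdivrMr// mulrC ler_pM2l ?pi_gt0// ler_nat.
rewrite /chebyshev_node ltr_cos ?in0pi// ?(ltnW (leq_trans kl lm))//.
by rewrite ltr_pM2r ?invr_gt0// ltr_pM2r ?pi_gt0// ltr_nat.
Qed.

Lemma chebyshev_nodeE m k : (0 < m)%N ->
  (chebyshev R m).[chebyshev_node m k] = (-1) ^+ k.
Proof.
move=> m0; rewrite (proj2 (chebyshevP R m)) mulrC divfK ?pnatr_eq0 -?lt0n//.
by rewrite mulr_natl -[_ *+ k]add0r (alternatingn (@cosDpi R)) cos0 mulr1.
Qed.

(** The alternation of [p - gpoly R n] at a node x_k < 1 is read off from that
    of (1 - x_k) (p - g_n)(x_k): the lower bound on [p] serves for even [k],
    the upper bound on (1 - x) p(x) for odd [k]. *)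
Lemma gpoly_unique n (p : {poly R}) :
  (size p <= n.+1)%N -> p.[1] = 1 ->
  (forall x, x \in `[-1, 1] -> 0 <= p.[x]) ->
  (forall x, x \in `[-1, 1] -> (1 - x) * p.[x] <= 2 / n.+1%:R ^+ 2) ->
  p = gpoly R n.
Proof.
move=> sp p1 p_ge0 p_le; apply/eqP; rewrite -subr_eq0; apply/eqP.
apply: (@alternating_poly_eq0 _ n.+1 (fun k => chebyshev_node n.+1 k)).
- by move=> i j ij; rewrite chebyshev_node_lt// ij -ltnS /=.
- by rewrite (leq_trans (size_polyD _ _))// geq_max sp size_polyN size_gpoly.
case=> [[|k] ltk] /=.
  by rewrite /chebyshev_node !mul0r cos0 hornerD hornerN p1 gpoly1 subrr mulr0.
set x := chebyshev_node _ _.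
have xlt1 : 0 < 1 - x.
  have : x < chebyshev_node n.+1 0 by apply: chebyshev_node_lt.
  by rewrite /chebyshev_node !mul0r cos0 subr_gt0.
rewrite -(pmulr_rge0 _ xlt1) mulrCA hornerD hornerN mulrBr horner_gpoly.
rewrite chebyshev_nodeE// -signr_odd; have xI := chebyshev_node_itv n.+1 k.+1.
case: (odd k.+1); last first.
  by rewrite expr0 subrr mul0r subr0 mul1r mulr_ge0 ?p_ge0// ltW.
by rewrite expr1 opprK mulN1r opprB subr_ge0 p_le.
Qed.

Lemma gpoly_le n x : x \in `[-1, 1] ->
  (1 - x) * (gpoly R n).[x] <= 2 / n.+1%:R ^+ 2.
Proof.
move=> /acosK <-; rewrite horner_gpoly (proj2 (chebyshevP R n.+1)).
by rewrite ler_pM2r ?invr_gt0 ?exprn_gt0// -[2 : R]/(1 + 1) lerD2l lerNl cos_geN1.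
Qed.

Lemma gpoly_attains n :
  (1 - chebyshev_node n.+1 1) * (gpoly R n).[chebyshev_node n.+1 1] =
  2 / n.+1%:R ^+ 2.
Proof. by rewrite horner_gpoly chebyshev_nodeE// opprK. Qed.

End ChebyshevFacts.

Theorem theorem4 (R : realType) (n : nat) (p : {poly R})
    (hdeg : (size p <= n.+1)%N)
    (hpos : forall x : R, x \in `[-1, 1] -> 0 <= p.[x])
    (hp1 : p.[1] = 1) :
  exists M : R,
    [/\ is_max [set (1 - x) * p.[x] | x in `[-1, 1]] M,
        M >= 2 / n.+1%:R ^+ 2
      & M = 2 / n.+1%:R ^+ 2 <-> p = gpoly R n].
Proof.
pose f x := (1 - x) * p.[x].
have fE : f = horner ((1 - 'X) * p) by apply/funext => x; rewrite !hornerE.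
have [||c cI cmax] := @EVT_max R f (-1) 1.
- by rewrite (le_trans (lerN10 R)) ?ler01.
- rewrite fE; apply: derivable_within_continuous => x _.
  exact: derivable_horner.
have p_g : f c <= 2 / n.+1%:R ^+ 2 -> p = gpoly R n.
  by move=> fc; apply: gpoly_unique => // x /cmax /le_trans; apply.
have g_fc : p = gpoly R n -> f c = 2 / n.+1%:R ^+ 2.
  move=> pE; apply/le_anti; rewrite {1}/f pE gpoly_le//=.
  rewrite -gpoly_attains -pE.
  exact: (cmax _ (chebyshev_node_itv _ _)).
exists (f c); split.
- by split; [exists c | move=> _ [x xI <-]; exact: cmax].
- by rewrite leNgt; apply/negP => fc; move: (fc); rewrite g_fc ?ltxx// p_g ?ltW.
- by split=> [fc|]; [apply: p_g; rewrite fc | exact: g_fc].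
Qed.
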